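(* Let $(\Omega,d)$ be a compact metric space, $T:\Omega\to\Omega$ a continuous map with $h_{\mathrm{top}}(T,\Omega)<\infty$, and let $\nu$ be a Borel probability measure on $\Omega$ (not necessarily $T$-invariant) which is Ahlfors-Bowen with parameter $h=h_{\mathrm{top}}(T,\Omega)$. Let $X=\{X_n\}_{n\ge 1}$ be a sequence of real-valued random variables on $\Omega$ (not assumed continuous) satisfying the weak Bowen condition. Let $I_X:\mathbb{R}\to[0,+\infty]$ be a rate function (i.e. a lower semicontinuous function) such that for every compact set $F\subset\mathbb{R}$, $$\limsup_{n\to\infty}\frac1n\log\nu\Big(\Big\{\omega\in\Omega:\tfrac1nX_n(\omega)\in F\Big\}\Big)\le-\inf_{t\in F}I_X(t).$$ Then for all $\alpha\in\mathcal{L}_X$, $$h_{\mathrm{top}}(T,K_\alpha)\le h_{\mathrm{top}}(T,\Omega)-I_X(\alpha).$$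
   Context: Random variables on $\Omega$ are Borel measurable functions. For $\alpha\in\mathbb{R}$, $K_\alpha=\{x\in\Omega:\lim_{n\to\infty}\frac1nX_n(x)=\alpha\}$ and $\mathcal{L}_X=\{\alpha\in\mathbb{R}:K_\alpha\ne\emptyset\}$. Bowen metric and balls: for $n\in\mathbb{N}=\{1,2,\dots\}$, $d_n(x,y)=\max_{0\le i\le n-1}d(T^ix,T^iy)$ and $B_n(x,\varepsilon)=\{y\in\Omega:d_n(x,y)<\varepsilon\}$. Topological entropy (Bowen) of an arbitrary subset $Z\subset\Omega$: for $t\in\mathbb{R}$, $\varepsilon>0$, $N\in\mathbb{N}$ let $$m(Z,t,\varepsilon,N)=\inf\Big\{\sum_{i=1}^\infty e^{-n_it}:Z\subset\bigcup_{i=1}^\infty B_{n_i}(x_i,\varepsilon),\ n_i\ge N\Big\}$$ (with $m(\emptyset,t,\varepsilon,N)=0$), $m(Z,t,\varepsilon)=\lim_{N\to\infty}m(Z,t,\varepsilon,N)$, $h_{\mathrm{top}}(T,Z,\varepsilon)=\inf\{t\in\mathbb{R}:m(Z,t,\varepsilon)=0\}$, and $h_{\mathrm{top}}(T,Z)=\lim_{\varepsilon\to0+}h_{\mathrm{top}}(T,Z,\varepsilon)$; by convention $h_{\mathrm{top}}(T,\emptyset)=-\infty$. A Borel probability measure $m$ on $\Omega$ is Ahlfors-Bowen with parameter $h>0$ if for every $\varepsilon>0$ there is a finite constant $C(\varepsilon)>0$ such that for every $n\ge1$ and all $\omega\in\Omega$, $\frac{1}{C(\varepsilon)}e^{-nh}\le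 m(B_n(\omega,\varepsilon))\le C(\varepsilon)e^{-nh}$. For $H:\Omega\to\mathbb{R}$, $v_{n,\delta}(H)=\sup_{d_n(y,z)\le\delta}|H(y)-H(z)|$. The sequence $\{X_n\}$ satisfies the weak Bowen condition if there exists $\delta>0$ such that $\lim_{n\to\infty}\frac{v_{n,\delta}(X_n)}{n}=0$. Conventions: $\log0=-\infty$, $\inf\emptyset=+\infty$. *)

(* Defs.v *)
From HB Require Import structures.
From mathcomp Require Import all_boot all_order all_algebra.
From mathcomp Require Import all_classical all_reals all_analysis.

Set Implicit Arguments.
Unset Strict Implicit.
Unset Printing Implicit Defensive.

Import Order.TTheory GRing.Theory Num.Theory.
Import numFieldNormedType.Exports.

Local Open Scope classical_set_scope.
Local Open Scope ring_scope.

(* The sigma-algebras of MathComp-Analysis live on pointed types.  A space that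
   carries a probability measure is nonempty, so the base point costs nothing;
   it plays no other role. *)
#[short(type="pmetricType")]
HB.structure Definition PointedMetric (R : numDomainType) :=
  {M of Pointed M & Metric R M}.

Definition borel (R : numDomainType) (Omega : pmetricType R) :=
  g_sigma_algebraType (@open Omega).

Section bowen.
Context {R : realType} {Omega : metricType R}.
Implicit Types (T : Omega -> Omega) (Z : set Omega) (e t : R) (n N : nat).

(* Meaningful for n >= 1.  Distances being nonnegative, the default value 0
   does not affect the maximum; bowen_dist T 0 is constantly 0. *)
Definition bowen_dist T n (x y : Omega) : R :=
  \big[Num.max/0]_(0 <= i < n) mdist (iter i T x) (iter i T y).

Definition bowen_ball T n (x : Omega) e : set Omega :=
  [set y | bowen_dist T n x y < e].

(* m(Z, t, e, N).  The empty set is treated apart: setting its value to 0 for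
   every real t is what makes its entropy -oo. *)
Definition entropy_premeasure T Z t e N : \bar R :=
  if Z == set0 then 0%E else
  ereal_inf [set s : \bar R | exists (n : nat -> nat) (x : nat -> Omega),
    [/\ forall i, (N <= n i)%N,
        Z `<=` \bigcup_i bowen_ball T (n i) (x i) e
      & s = (\sum_(0 <= i <oo) (expR (- ((n i)%:R * t)))%:E)%E]].

(* m(Z, t, e); nondecreasing in N, so the limit exists and ignores N = 0 *)
Definition entropy_measure T Z t e : \bar R :=
  limn (entropy_premeasure T Z t e).

Definition htop_scale T Z e : \bar R :=
  ereal_inf [set t%:E | t in [set t : R | entropy_measure T Z t e = 0%E]].

(* htop_scale is nonincreasing in e, so the one-sided limit exists. *)
Definition htop T Z : \bar R := lim (htop_scale T Z e @[e --> 0^'+]).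

Definition variation T n e (H : Omega -> R) : \bar R :=
  ereal_sup [set `|H yz.1 - H yz.2|%:E |
    yz in [set yz : Omega * Omega | bowen_dist T n yz.1 yz.2 <= e]].

Definition weak_bowen T (X : nat -> Omega -> R) : Prop :=
  exists2 delta : R, 0 < delta &
    ((n%:R^-1)%:E * variation T n delta (X n))%E @[n --> \oo] --> 0%E.

Definition level_set (X : nat -> Omega -> R) (alpha : R) : set Omega :=
  [set x | X n x / n%:R @[n --> \oo] --> alpha].

Definition spectrum (X : nat -> Omega -> R) : set R :=
  [set alpha | level_set X alpha !=set0].

End bowen.

Definition ahlfors_bowen (R : realType) (Omega : pmetricType R)
    (T : Omega -> Omega) (nu : probability (borel Omega) R) (h : R) : Prop :=
  0 < h /\
  forall e : R, 0 < e -> exists2 C : R, 0 < C &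
    forall (n : nat) (w : Omega), (1 <= n)%N ->
      ((C^-1 * expR (- (n%:R * h)))%:E <= nu (bowen_ball T n w e) /\
       nu (bowen_ball T n w e) <= (C * expR (- (n%:R * h)))%:E)%E.

(* Neither convexity nor compactness of the sublevel sets is required. *)
Definition rate_function (R : realType) (I : R -> \bar R) : Prop :=
  (forall t, (0 <= I t)%E) /\ lower_semicontinuous I.

Definition ldp_upper_compact (R : realType) (Omega : pmetricType R)
    (nu : probability (borel Omega) R) (X : nat -> Omega -> R)
    (I : R -> \bar R) : Prop :=
  forall F : set R, compact F ->
    (limn_esup (fun n => (n%:R^-1)%:E *
                         lne (nu [set w | F (X n w / n%:R)%R]))
     <= - ereal_inf [set I t | t in F])%E.

(* Main.v *)
Require Import Defs.
From HB Require Import structures.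
From mathcomp Require Import all_boot all_order all_algebra.
From mathcomp Require Import all_classical all_reals all_analysis.
From mathcomp Require Import lra.
Import Order.TTheory GRing.Theory Num.Theory.
Import numFieldNormedType.Exports.
Local Open Scope classical_set_scope.
Local Open Scope ring_scope.

(** Write [h] for the entropy of the whole space, [K] for the level set of
[alpha], and fix a real [s < I_X alpha].  The idea is to count how many Bowen
balls are needed at time [n] to cover the points whose average [X n x / n] is
close to [alpha], by comparing masses for [nu].

By lower semicontinuity the rate function stays above some [s' > s] on a small
compact interval around [alpha], so the large deviation bound gives, for large
[n], mass at most [exp(- n s)] to [F n], the set of points whose average is
within [eta] of [alpha] ([ldp_deviation]).  Let [A n] be the smaller set where
the average is within [eta / 2] of [alpha].  By the weak Bowen condition the
averages vary by at most [eta / 2] on small Bowen balls, so the balls centred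
in [A n] stay inside [F n] ([weak_bowen_average]).  Take a maximal
[e]-separated subset of [A n]: its balls of radius [e] cover [A n], while its
balls of radius [e / 2] are disjoint, lie in [F n] and each have mass at least
[exp(- n h) / C].  Hence it has at most [C exp(n (h - s))] points
([bowen_spanning_card]).

Every point of [K] belongs to [A n] for all large [n].  Two things follow.
First, [K] being nonempty, the covering families are eventually nonempty, so
[s <= h]; this is what rules out [I_X alpha = +oo].  Second, for every
[t > h - s] the families at times [n >= N] together cover [K] with a total
weight dominated by the tail of a convergent geometric series, so the
Caratheodory quantity at parameter [t] vanishes and the entropy of [K] is at
most [h - s] ([htop_scale_le_limsup_cover], [htop_level_set_le]).  Letting [s]
increase to [I_X alpha] finishes the proof. *)

(** * Bowen metrics and separated sets *)

Section bowen_metric.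
Context {R : realType} {Omega : metricType R} (T : Omega -> Omega).

Lemma bowen_dist_ge0 n (x y : Omega) : 0 <= bowen_dist T n x y.
Proof. by rewrite /bowen_dist big_mkord; apply: bigmax_ge_id. Qed.

Lemma bowen_dist_ltP n (x y : Omega) e : 0 < e ->
  bowen_dist T n x y < e <->
  forall i, (i < n)%N -> mdist (iter i T x) (iter i T y) < e.
Proof.
move=> e0; rewrite /bowen_dist big_mkord; split.
  by move=> /bigmax_ltP[_ h] i ni; exact: (h (Ordinal ni)).
by move=> h; apply/bigmax_ltP; split=> // i _; exact: h.
Qed.

Lemma bowen_dist_sym n (x y : Omega) : bowen_dist T n x y = bowen_dist T n y x.
Proof. by apply: eq_bigr => i _; rewrite metric_sym. Qed.

Lemma bowen_dist_triangle n (x y z : Omega) :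
  bowen_dist T n x z <= bowen_dist T n x y + bowen_dist T n y z.
Proof.
rewrite {1}/bowen_dist big_mkord; apply/bigmax_leP; split=> [|i _].
  by rewrite addr_ge0 ?bowen_dist_ge0.
apply: (le_trans (metric_triangle _ (iter i T y) _)).
rewrite /bowen_dist !big_mkord.
apply: lerD;
  [exact: (le_bigmax _ (fun i : 'I_n => mdist (iter i T x) (iter i T y)))
  |exact: (le_bigmax _ (fun i : 'I_n => mdist (iter i T y) (iter i T z)))].
Qed.

Lemma bowen_ball_open n (x : Omega) e :
  continuous T -> 0 < e -> open (bowen_ball T n x e).
Proof.
move=> cT e0; elim: n => [|n IHn].
  rewrite (_ : bowen_ball _ _ _ _ = setT); first exact: openT.
  by apply/seteqP; split=> // y _; apply/bowen_dist_ltP.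
have -> : bowen_ball T n.+1 x e =
    bowen_ball T n x e `&` (iter n T @^-1` [set z | mdist (iter n T x) z < e]).
  apply/seteqP; split=> y; rewrite /bowen_ball/= !bowen_dist_ltP//.
    by move=> h; split=> [i ni|]; apply: h => //; exact: ltnW.
  by move=> [h hn] i; rewrite ltnS leq_eqVlt => /predU1P[->//|/h].
apply: openI => //; apply: open_comp => [y _|].
  elim: {IHn} n y => [|n IHn] y /=; first exact: cvg_id.
  by apply: continuous_comp; [exact: IHn|exact: cT].
rewrite openE => z /= zx; rewrite /interior.
apply/nbhs_ballP; exists (e - mdist (iter n T x) z); first by rewrite /= subr_gt0.
move=> w; rewrite -metricType_numDomainType.ball_mdistE /= => zw.
by rewrite (le_lt_trans (metric_triangle _ z _))// -ltrBrDl.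
Qed.

Lemma bowen_ball_disjoint n e (x y : Omega) : e <= bowen_dist T n x y ->
  bowen_ball T n x (e / 2) `&` bowen_ball T n y (e / 2) = set0.
Proof.
move=> exy; rewrite -subset0 => z [/= xz yz].
have := bowen_dist_triangle n x z y.
rewrite leNgt => /negP; apply; rewrite (lt_le_trans _ exy)//.
by rewrite [e]splitr ltrD// bowen_dist_sym.
Qed.

Definition bowen_separated n e (s : seq Omega) :=
  pairwise (fun x y => e <= bowen_dist T n x y) s.

(** A separated family of maximal size spans: a point of [A] far from all its
members could be added to it.  The maximum exists because the sizes are
bounded. *)
Lemma exists_spanning_bowen_separated n e (A : set Omega) (M : nat) : 0 < e ->
  (forall s, bowen_separated n e s -> {in s, forall x, A x} -> (size s <= M)%N) ->
  exists s, [/\ bowen_separated n e s, {in s, forall x, A x} &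
    forall y, A y -> exists2 x, x \in s & bowen_ball T n x e y].
Proof.
move=> e0 sizeM.
pose P k := `[< exists s, [/\ size s = k, bowen_separated n e s & {in s, forall x, A x}] >].
have P0 : exists k, P k by exists 0%N; apply/asboolP; exists [::]; split.
have PM k : P k -> (k <= M)%N.
  by move=> /asboolP[s [<- sep sA]]; exact: sizeM.
have [m /asboolP[s [<- sep sA]] mmax] := ex_maxnP P0 PM.
exists s; split=> // y Ay; apply: contrapT => nspan.
suff /mmax : P (size s).+1 by rewrite ltnn.
apply/asboolP; exists (y :: s); split=> //.
  rewrite /bowen_separated/= -/(bowen_separated n e s) sep andbT; apply/allP => x xs.
  rewrite leNgt; apply/negP => yx; apply: nspan; exists x => //.
  by rewrite /bowen_ball/= bowen_dist_sym.
by move=> x; rewrite inE => /orP[/eqP->//|/sA].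
Qed.
End bowen_metric.

(** * Counting balls by mass *)

Section packing.
Context {d : measure_display} {S : measurableType d} {R : realType}.

(** Peeling off one member [B i] at a time leaves [F `\` B i], which still
contains all the remaining members by disjointness; no union over the family
is ever formed. *)
Lemma packing_le_measure (mu : {measure set S -> \bar R}) (I : eqType)
    (B : I -> set S) (F : set S) (c : R) (s : seq I) :
  (forall i, measurable (B i)) -> measurable F ->
  {in s, forall i, B i `<=` F /\ (c%:E <= mu (B i))%E} ->
  pairwise (fun i j => `[< B i `&` B j = set0 >]) s ->
  (((size s)%:R * c)%:E <= mu F)%E.
Proof.
move=> mB; elim: s F => [F _ _ _|i s IHs F mF sF]; first by rewrite mul0r.
rewrite [pairwise _ _]/= => /andP[/allP iB sB].
have [iF ci] := sF i (mem_head _ _).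
rewrite (measureDI mu mF (mB i)) -natr1 mulrDl mul1r EFinD.
apply: leeD; last by rewrite (setIidr iF).
apply: IHs => //; first exact: measurableD.
move=> j js.
have [jF cj] : B j `<=` F /\ (c%:E <= mu (B j))%E
  by apply: sF; rewrite inE js orbT.
split=> // z Bz.
split; first exact: jF.
by move=> iz; have /asboolP/seteqP[/(_ z) + _] := iB j js; apply.
Qed.
End packing.

(** The same finite set is used at two scales: at radius [e / 2] its balls are
disjoint inside [F], which bounds its size by mass; at radius [e] maximality
makes its balls cover [A].  The mass bound is also what makes a maximal
separated set exist. *)
Lemma bowen_spanning_card {R : realType} {Omega : pmetricType R}
    (T : Omega -> Omega) (mu : {measure set (borel Omega) -> \bar R})
    n e (A F : set (borel Omega)) (b c : R) :
  continuous T -> 0 < e -> 0 < c -> measurable F ->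
  (forall x : Omega, A x -> bowen_ball T n x (e / 2) `<=` F) ->
  (forall x : Omega, (c%:E <= mu (bowen_ball T n x (e / 2)))%E) ->
  (mu F <= b%:E)%E ->
  exists s : seq Omega, (size s)%:R * c <= b /\
    forall y, A y -> exists2 x, x \in s & bowen_ball T n x e y.
Proof.
move=> cT e0 c0 mF AF cmu Fb.
have card s : bowen_separated T n e s -> {in s, forall x, A x} -> (size s)%:R * c <= b.
  move=> sep sA; rewrite -lee_fin; apply: le_trans Fb.
  apply: (@packing_le_measure _ _ _ mu Omega (fun x => bowen_ball T n x (e / 2))).
  - move=> x; apply: sub_sigma_algebra.
    by apply: bowen_ball_open => //; rewrite divr_gt0.
  - exact: mF.
  - by move=> x /sA Ax; split; [exact: AF|exact: cmu].
  - apply: sub_pairwise sep => x y exy; apply/asboolP.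
    exact: bowen_ball_disjoint.
have cardM s : bowen_separated T n e s -> {in s, forall x, A x} ->
    (size s <= Num.bound (b / c))%N.
  move=> sep sA; have := card s sep sA; rewrite -ler_pdivlMr// => sbc.
  have /(le_lt_trans sbc) : b / c < (Num.bound (b / c))%:R.
    by apply: archi_boundP; apply: le_trans sbc.
  by rewrite ltr_nat => /ltnW.
have [s [sep sA span]] := exists_spanning_bowen_separated T n e A _ e0 cardM.
by exists s; split=> //; exact: card.
Qed.

(** * Bounding entropy by covers *)

Lemma nneseries_le {R : realType} (u : nat -> R) (M : R) :
  (forall n, 0 <= u n) -> (forall n, \sum_(0 <= k < n) u k <= M) ->
  (\sum_(0 <= k <oo) (u k)%:E <= M%:E)%E.
Proof.
move=> u0 uM; apply: lime_le.
  by apply: is_cvg_nneseries => k _ _; rewrite lee_fin.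
by near=> n; rewrite sumEFin lee_fin.
Unshelve. all: by end_near. Qed.

Lemma sum_geometric_le {R : realType} (C q : R) (N K : nat) :
  0 <= C -> 0 < q < 1 ->
  \sum_(0 <= n < K) C * q ^+ (N + n) <= C * q ^+ N / (1 - q).
Proof.
move=> C0 /andP[q0 q1].
have -> : \sum_(0 <= n < K) C * q ^+ (N + n) =
    series (geometric (C * q ^+ N) q) K.
  by apply: eq_bigr => n _; rewrite /geometric/= exprD mulrA.
by apply: geometric_le_lim;
  rewrite // ?ger0_norm ?mulr_ge0 ?exprn_ge0 ?(ltW q0).
Qed.

Section entropy.
Context {R : realType} {Omega : metricType R} (T : Omega -> Omega).
Implicit Types (Z : set Omega) (t e : R).

Lemma entropy_premeasure_ge0 Z t e N : (0 <= entropy_premeasure T Z t e N)%E.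
Proof.
rewrite /entropy_premeasure; case: ifP => // _.
apply: le_ereal_inf_tmp => _ [n [x [_ _ ->]]].
by apply: nneseries_ge0 => k _ _; rewrite lee_fin expR_ge0.
Qed.

Lemma entropy_premeasure_nondecreasing Z t e :
  {homo entropy_premeasure T Z t e : N M / (N <= M)%N >-> (N <= M)%E}.
Proof.
move=> N M NM; rewrite /entropy_premeasure; case: ifP => // _.
apply: le_ereal_inf => _ [n [x [nM Zx ->]]].
by exists n, x; split=> // i; exact: leq_trans NM (nM i).
Qed.

Lemma entropy_premeasure_nonincreasing Z t e e' N : e <= e' ->
  (entropy_premeasure T Z t e' N <= entropy_premeasure T Z t e N)%E.
Proof.
move=> ee'; rewrite /entropy_premeasure; case: ifP => // _.
apply: le_ereal_inf => _ [n [x [nN Zx ->]]].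
exists n, x; split=> // z /Zx[i _ xz]; exists i => //.
exact: lt_le_trans xz ee'.
Qed.

Lemma is_cvg_entropy_premeasure Z t e : cvgn (entropy_premeasure T Z t e).
Proof. exact/ereal_nondecreasing_is_cvgn/entropy_premeasure_nondecreasing. Qed.

Lemma htop_scale_nonincreasing Z e e' : e <= e' ->
  (htop_scale T Z e' <= htop_scale T Z e)%E.
Proof.
move=> ee'; apply: le_ereal_inf => _ [t /= t0 <-]; exists t => //=.
apply/eqP; rewrite eq_le -{1}t0; apply/andP; split.
  apply: lee_lim; [exact: is_cvg_entropy_premeasure..|].
  by apply: nearW => N; exact: entropy_premeasure_nonincreasing.
apply: lime_ge; first exact: is_cvg_entropy_premeasure.
by apply: nearW => N; exact: entropy_premeasure_ge0.
Qed.

(** Monotonicity in the scale is what guarantees that the limit defining [htop]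
exists, so that an eventual bound on [htop_scale] passes to it. *)
Lemma htop_le Z (c : \bar R) :
  (\forall e \near 0^'+, (htop_scale T Z e <= c)%E) -> (htop T Z <= c)%E.
Proof.
move=> Zc; apply: lime_le => //.
apply: nonincreasing_at_right_is_cvge; near=> e => x y _ _.
exact: htop_scale_nonincreasing.
Unshelve. all: by end_near. Qed.

(** Finite families [s n] of balls at the times [N + n] must be turned into
covers indexed by the natural numbers.  The index set is [nat * nat], row [n]
listing [s n] followed by infinitely many repetitions of an arbitrary ball;
giving these repetitions times tending to infinity with both indices makes them
contribute only the second term of the bound, a double geometric series. *)
Lemma entropy_premeasure_le_cover Z t e N (s : nat -> seq Omega) (C q : R) :
  0 < t -> 0 <= C -> 0 < q < 1 ->
  Z `<=` [set z | exists n, exists2 x, x \in s n & bowen_ball T (N + n) x e z] ->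
  (forall n, (size (s n))%:R * expR (- t) ^+ (N + n) <= C * q ^+ (N + n)) ->
  (entropy_premeasure T Z t e N <=
   (C * q ^+ N / (1 - q) +
    (1 - expR (- t))^-1 * expR (- t) ^+ N / (1 - expR (- t)))%:E)%E.
Proof.
move=> t0 C0 q01 Zs sC; set p := expR (- t).
have p01 : 0 < p < 1 by rewrite expR_gt0 expR_lt1 oppr_lt0.
have /andP[p0 p1] := p01; have /andP[q0 q1] := q01.
have ip0 : 0 <= (1 - p)^-1 by rewrite invr_ge0 subr_ge0 ltW.
have iq0 : 0 <= (1 - q)^-1 by rewrite invr_ge0 subr_ge0 ltW.
rewrite /entropy_premeasure; case: ifPn => [_|/set0P[z0 _]].
  by rewrite lee_fin addr_ge0 ?mulr_ge0 ?exprn_ge0 ?(ltW q0) ?(ltW p0).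
(* the rows are enumerated together through a bijection of nat with nat * nat *)
have [phi phi_bij] : exists phi : nat -> nat * nat, set_bij setT setT phi.
  apply/card_set_bijP; rewrite card_eq_sym; exact: card_nat2.
pose level (i : nat * nat) :=
  (if i.2 < size (s i.1) then N + i.1 else N + i.1 + i.2)%N.
pose centre (i : nat * nat) := nth z0 (s i.1) i.2.
apply: (@le_trans _ _ (\sum_(0 <= i <oo) (expR (- ((level (phi i))%:R * t)))%:E)%E).
  apply: ereal_inf_lbound; exists (level \o phi), (centre \o phi); split=> //=.
    move=> i; rewrite /level; case: ifP => _; first exact: leq_addr.
    by rewrite -addnA leq_addr.
  move=> z /Zs[n [x xs xz]].
  have [_ _ /(_ (n, index x (s n)) Logic.I) [i _ phii]] := phi_bij.
  exists i => //=; rewrite phii /level/centre/= index_mem xs nth_index//.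
pose a i : \bar R := (p ^+ level i)%:E.
have a0 i : (0 <= a i)%E by rewrite lee_fin exprn_ge0// ltW.
rewrite (eq_eseriesr (g := a \o phi)); last first.
  by move=> i _; rewrite /a/= /p -expRM_natl mulrN.
rewrite nneseries_esumT; last by move=> n; exact: a0.
rewrite -(reindex_esum _ _ phi a phi_bij).
have -> : (\esum_(i in setT) a i =
    \esum_(n in setT) \esum_(m in setT) a (n, m))%E.
  rewrite esum_esum//.
  have -> : [set: nat] `*`` (fun=> [set: nat]) = setT by apply/seteqP; split.
  by apply: eq_esum => -[].
(* a row weighs at most its true part plus the padding, a geometric series *)
have row n : (\esum_(m in setT) a (n, m) <=
    (C * q ^+ (N + n) + (1 - p)^-1 * p ^+ (N + n))%:E)%E.
  rewrite -nneseries_esumT//; apply: nneseries_le => [m|K].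
    by rewrite exprn_ge0// ltW.
  apply: (@le_trans _ _ (\sum_(0 <= m < K)
      ((if (m < size (s n))%N then p ^+ (N + n) else 0) + p ^+ (N + n) * p ^+ m))).
    apply: ler_sum => m _; rewrite /level/=; case: ifP => _.
      by rewrite lerDl mulr_ge0 ?exprn_ge0 ?(ltW q0) ?(ltW p0).
    by rewrite add0r exprD.
  rewrite big_split/=; apply: lerD.
    apply: le_trans (sC n); rewrite -big_mkcond/= -/p.
    rewrite big_const_seq iter_addr_0 -[leLHS]mulr_natl.
    apply: ler_wpM2r; first by rewrite exprn_ge0 ?(ltW p0).
    rewrite ler_nat.
    rewrite -(size_filter _ (index_iota 0 K)) -[leqRHS](size_iota 0).
    apply: uniq_leq_size; first by rewrite filter_uniq// iota_uniq.
    by move=> m; rewrite mem_filter mem_iota => /andP[].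
  have := sum_geometric_le (p ^+ (N + n)) p 0 K.
  rewrite expr0 mulr1 mulrC; apply => //.
  by rewrite exprn_ge0 ?ltW.
apply: (@le_trans _ _ (\esum_(n in setT)
    (C * q ^+ (N + n) + (1 - p)^-1 * p ^+ (N + n))%:E)%E).
  by apply: le_esum => n _; exact: row.
have b0 n : 0 <= C * q ^+ (N + n) + (1 - p)^-1 * p ^+ (N + n).
  by rewrite addr_ge0 ?mulr_ge0 ?exprn_ge0 ?(ltW q0) ?(ltW p0).
rewrite -nneseries_esumT => [|n]; last by rewrite lee_fin.
apply: nneseries_le => // K; rewrite big_split/=.
by apply: lerD; apply: sum_geometric_le.
Qed.

End entropy.

(** At parameter [kappa + d] the families of times [n >= N] weigh at most a
constant times [expR (- d) ^+ N], which tends to [0]. *)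
Lemma htop_scale_le_limsup_cover {R : realType} {Omega : metricType R}
    (T : Omega -> Omega) Z e (E : nat -> seq Omega) (C kappa : R) :
  0 <= kappa -> 0 <= C ->
  (\forall n \near \oo, (size (E n))%:R <= C * expR (n%:R * kappa)) ->
  (forall z N, Z z -> exists n, (N <= n)%N /\
     exists2 x, x \in E n & bowen_ball T n x e z) ->
  (htop_scale T Z e <= kappa%:E)%E.
Proof.
move=> kappa0 C0 [N0 _ EC] ZE; apply/lee_addgt0Pr => d d0.
have t0 : 0 < kappa + d by rewrite ltr_wpDl.
have geo (a c r : R) : 0 < r -> a * expR (- r) ^+ N / c @[N --> \oo] --> (0 : R).
  move=> r0; rewrite -(mul0r c^-1); apply: cvgMl; apply: cvg_geometric.
  by rewrite ger0_norm ?expR_ge0// expR_lt1 oppr_lt0.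
apply: ereal_inf_lbound; exists (kappa + d); last by rewrite EFinD.
apply: cvg_lim => //.
pose q := expR (- d); pose p := expR (- (kappa + d)).
apply: (squeeze_cvge (f := cst 0%E) (h := fun N =>
  (C * q ^+ N / (1 - q) + (1 - p)^-1 * p ^+ N / (1 - p))%:E)); last 2 first.
- exact: cvg_cst.
- apply: cvg_EFin; first exact: nearW.
  by rewrite -(addr0 0); apply: cvgD; apply: geo.
exists N0 => // N /= N0N; rewrite entropy_premeasure_ge0/=.
apply: (@entropy_premeasure_le_cover _ _ _ _ _ _ _ (fun n => E (N + n)%N)) => //.
- by rewrite expR_gt0 expR_lt1 oppr_lt0.
- move=> z /(ZE _ N)[n [Nn [x xE xz]]].
  by exists (n - N)%N; rewrite subnKC//; exists x.
- move=> n; have /EC : (N0 <= N + n)%N by rewrite (leq_trans N0N)// leq_addr.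
  set k := (N + n)%N; rewrite -(ler_pM2r (exprn_gt0 k (expR_gt0 (- (kappa + d))))).
  move=> /le_trans; apply; rewrite -mulrA /q -!expRM_natl -expRD.
  by rewrite ler_wpM2l// ler_expR; lra.
Qed.

(** * Consequences of the asymptotic hypotheses *)

(** The upper limit is the infimum of the tail suprema, one of which is therefore
below [l]. *)
Lemma limn_esup_lt_near {R : realType} (u : (\bar R)^nat) l :
  (limn_esup u < l)%E -> \forall n \near \oo, (u n < l)%E.
Proof.
rewrite limn_esup_lim (cvg_lim _ (@cvg_esups_inf _ u))// => /ereal_inf_lt[_ [N _ <-] Nl].
exists N => // n /= Nn; apply: le_lt_trans Nl; apply: ereal_sup_ubound.
by exists n.
Qed.

Lemma lne_ltW {R : realType} (x : \bar R) (r : R) :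
  (lne x < r%:E)%E -> (x <= (expR r)%:E)%E.
Proof.
case: x => [x| |]//=; last by rewrite leNye.
case: ifPn => [x0 _|]; first by rewrite lee_fin (le_trans x0)// expR_ge0.
rewrite -ltNge lte_fin lee_fin => x0 xr.
by rewrite -(@lnK _ x) ?posrE// ler_expR ltW.
Qed.

Lemma variation_ge {R : realType} {Omega : metricType R} (T : Omega -> Omega)
    n e (H : Omega -> R) (y z : Omega) : bowen_dist T n y z <= e ->
  (`|H y - H z|%:E <= Defs.variation T n e H)%E.
Proof. by move=> yz; apply: ereal_sup_ubound; exists (y, z). Qed.

(** The variation over [bowen_dist T n y z <= delta], divided by [n], bounds every
single difference of averages [X n / n] and tends to [0]. *)
Lemma weak_bowen_average {R : realType} {Omega : metricType R}
    (T : Omega -> Omega) (X : nat -> Omega -> R) : weak_bowen T X ->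
  exists2 delta : R, 0 < delta & forall eta : R, 0 < eta ->
    \forall n \near \oo, forall y z, bowen_dist T n y z <= delta ->
      `|X n y / n%:R - X n z / n%:R| <= eta.
Proof.
move=> [delta delta0 v0]; exists delta => // eta eta0.
have : \forall n \near \oo,
    ((n%:R^-1)%:E * Defs.variation T n delta (X n) < eta%:E)%E.
  apply: (v0 [set x | (x < eta%:E)%E]); apply: open_nbhs_nbhs.
  by split; [exact: open_ereal_lt_ereal|rewrite /= lte_fin].
apply: filterS => n vn y z yz.
rewrite -mulrBl normrM normfV normr_nat mulrC -lee_fin EFinM.
apply: le_trans (ltW vn); apply: lee_wpmul2l; last exact: variation_ge.
by rewrite lee_fin invr_ge0.
Qed.

(** The strict inequality [s < I alpha] leaves room for an intermediate [s'] that
bounds [I] from below on an interval; the upper bound on that interval then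
has exponential rate at least [s' > s], and holds with rate [s] for each
large [n]. *)
Lemma ldp_deviation {R : realType} {Omega : pmetricType R}
    (nu : probability (borel Omega) R) (X : nat -> Omega -> R) (I : R -> \bar R)
    (alpha s : R) :
  rate_function I -> ldp_upper_compact nu X I -> (s%:E < I alpha)%E ->
  exists2 eta : R, 0 < eta & \forall n \near \oo,
    (nu [set w | (`|alpha - X n w / n%:R| <= eta)%R] <= (expR (- (n%:R * s)))%:E)%E.
Proof.
move=> [_ lscI] ldpI sI.
have [s' ss' s'I] : exists2 s' : R, s < s' & (s'%:E < I alpha)%E.
  case: (I alpha) sI => [r| |]// sr.
    by exists ((s + r) / 2); move: sr; rewrite !lte_fin; lra.
  by exists (s + 1); rewrite ?ltry//; lra.
have [V /nbhs_ballP[r /= r0 rV] VI] := lscI _ _ s'I.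
exists (r / 2); first by rewrite divr_gt0.
pose F : set R := `[alpha - r / 2, alpha + r / 2]%classic.
have FE x : F x = (`|alpha - x| <= r / 2) :> Prop.
  by rewrite /F/= in_itv/= ler_distlC.
have s'F : (s'%:E <= ereal_inf [set I t | t in F])%E.
  apply: le_ereal_inf_tmp => _ [t Ft <-]; apply/ltW/VI/rV.
  by move: Ft; rewrite FE /ball/= => /le_lt_trans; apply; lra.
have : (limn_esup (fun n => (n%:R^-1)%:E * lne (nu [set w | F (X n w / n%:R)%R]))
    < (- s)%:E)%E.
  have cF : compact F by exact: segment_compact.
  apply: le_lt_trans (ldpI F cF) _.
  apply: (@le_lt_trans _ _ (- s'%:E)%E); first by rewrite leeN2.
  by rewrite -EFinN lte_fin ltrN2.
move=> /limn_esup_lt_near; apply: filterS2 (nbhs_infty_gt 0) => n n0.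
rewrite lte_pdivrMl ?ltr0n// -EFinM mulrN => /lne_ltW.
rewrite (_ : [set w | F (X n w / n%:R)] = [set w | `|alpha - X n w / n%:R| <= r / 2])//.
by apply/seteqP; split=> w /=; rewrite FE.
Qed.

(** * Entropy of level sets *)

(** The inequality [s <= h] comes first because the entropy bound rests on covers
with nonnegative growth rate [h - s].  It holds because otherwise the sets
[A n] of points with average close to [alpha] would be covered by fewer than
one ball for large [n], whereas they eventually contain each point of the
level set. *)
Lemma htop_level_set_le {R : realType} {Omega : pmetricType R}
    (T : Omega -> Omega) (nu : probability (borel Omega) R)
    (X : nat -> Omega -> R) (I : R -> \bar R) (h alpha s : R) :
  continuous T -> ahlfors_bowen T nu h ->
  (forall n : nat, (1 <= n)%N ->
     measurable_fun [set: borel Omega] (X n : borel Omega -> R)) ->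
  weak_bowen T X -> rate_function I -> ldp_upper_compact nu X I ->
  level_set X alpha !=set0 -> (s%:E < I alpha)%E ->
  s <= h /\ (htop T (level_set X alpha) <= (h - s)%:E)%E.
Proof.
move=> cT [h0 AB] mX /weak_bowen_average[delta delta0 vX] rI ldpI [x0 Kx0] sI.
have [eta eta0 devX] := ldp_deviation nu X I alpha s rI ldpI sI.
have eta20 : 0 < eta / 2 by rewrite divr_gt0.
pose A n : set Omega := [set w | `|alpha - X n w / n%:R| <= eta / 2].
pose F n : set Omega := [set w | `|alpha - X n w / n%:R| <= eta].
have KA z : level_set X alpha z -> \forall n \near \oo, A n z.
  by move=> /cvgr_dist_le /(_ _ eta20).
have mF n : (0 < n)%N -> measurable (F n : set (borel Omega)).
  move=> n0; have mXn : measurable_fun [set: borel Omega] (fun w => X n w / n%:R).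
    by apply: measurable_realfun.measurable_funM => //; exact: mX.
  have := mXn measurableT `[alpha - eta, alpha + eta]%classic (measurable_itv _).
  rewrite setTI; congr (measurable _).
  by apply/seteqP; split=> w; rewrite /F/= in_itv/= ler_distlC.
have AF e : 0 < e <= delta ->
    \forall n \near \oo, forall x, A n x -> bowen_ball T n x e `<=` F n.
  move=> /andP[e0 edelta]; have := vX _ eta20; apply: filterS => n vn x Ax y xy.
  have := vn x y (ltW (lt_le_trans xy edelta)).
  move: Ax; rewrite /A /F/= => Ax Xxy.
  rewrite -[alpha](subrK (X n x / n%:R)) -addrA (le_trans (ler_normD _ _))//.
  by rewrite [eta]splitr lerD.
pose spans C e n (E : seq Omega) :=
    (size E)%:R <= C * expR (n%:R * (h - s)) /\
    forall y, A n y -> exists2 x, x \in E & bowen_ball T n x e y.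
have spanning e : 0 < e <= delta -> exists2 C : R, 0 <= C &
    \forall n \near \oo, exists E, spans C e n E.
  move=> /andP[e0 edelta]; have e20 : 0 < e / 2 by rewrite divr_gt0.
  have [C C0 CAB] := AB _ e20; exists C; first exact: ltW.
  near=> n; have n0 : (0 < n)%N by near: n; exact: nbhs_infty_gt.
  have c0 : 0 < C^-1 * expR (- (n%:R * h)) by rewrite mulr_gt0 ?invr_gt0 ?expR_gt0.
  have AFn : forall x, A n x -> bowen_ball T n x (e / 2) `<=` F n.
    by near: n; apply: AF; rewrite e20/=; lra.
  have devn : (nu (F n) <= (expR (- (n%:R * s)))%:E)%E by near: n.
  have [E [sE AE]] := bowen_spanning_card T nu n e (A n) (F n) _ _ cT e0 c0
    (mF n n0) AFn (fun x => (CAB n x n0).1) devn.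
  exists E; split=> //; move: sE; rewrite -ler_pdivlMr// => /le_trans; apply.
  rewrite invfM invrK -expRN opprK mulrCA -expRD.
  by rewrite ler_wpM2l ?(ltW C0)// ler_expR; lra.
have sh : s <= h.
  rewrite leNgt; apply/negP => hs.
  have delta_le : 0 < delta <= delta by rewrite delta0 lexx.
  have [C C0 spanC] := spanning delta delta_le.
  have q1 : `|expR (- (s - h))| < 1.
    by rewrite ger0_norm ?expR_ge0// expR_lt1 oppr_lt0 subr_gt0.
  have /cvgr_lt/(_ 1 ltr01) small := cvg_geometric C q1.
  near \oo => n.
  have [E [EC AE]] : exists E, spans C delta n E by near: n.
  have [x xE _] : exists2 x, x \in E & bowen_ball T n x delta x0.
    by apply: AE; near: n; exact: KA.
  have : (size E)%:R < 1 :> R.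
    apply: (le_lt_trans EC); rewrite -(opprB s h) expRM_natl.
    by near: n.
  by rewrite (ltr_nat _ _ 1) ltnS leqn0 size_eq0 => /eqP E0; rewrite E0 in xE.
split=> //; apply: htop_le; near=> e.
have edelta : 0 < e <= delta.
  apply/andP; split; near: e; first by exact: nbhs_right_gt.
  exact: nbhs_right_le.
have [C C0 spanC] := spanning e edelta.
pose E n := xget [::] [set E | spans C e n E].
have EP : \forall n \near \oo, spans C e n (E n).
  by apply: filterS spanC => n; exact: (@xgetPex _ [::]).
apply: (@htop_scale_le_limsup_cover _ _ _ _ _ E C) => //.
- by rewrite subr_ge0.
- by apply: filterS EP => n [].
- move=> z N Kz.
  near \oo => n; exists n; split; first by near: n; exact: nbhs_infty_ge.
  have [_ AE] : spans C e n (E n) by near: n.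
  by apply: AE; near: n; exact: KA.
Unshelve. all: by end_near. Qed.

Theorem theoremA (R : realType) (Omega : pmetricType R)
  (compact_Omega : compact [set: Omega])
  (T : Omega -> Omega) (cont_T : continuous T)
  (htop_fin : (htop T [set: Omega] < +oo)%E)
  (nu : probability (borel Omega) R)
  (nu_AB : ahlfors_bowen T nu (fine (htop T [set: Omega])))
  (X : nat -> Omega -> R)
  (meas_X : forall n : nat, (1 <= n)%N ->
     measurable_fun [set: borel Omega] (X n : borel Omega -> R))
  (wb_X : weak_bowen T X)
  (I_X : R -> \bar R) (rate_I : rate_function I_X)
  (ldp_X : ldp_upper_compact nu X I_X)
  (alpha : R) (alpha_X : spectrum X alpha) :
  (htop T (level_set X alpha) <= htop T [set: Omega] - I_X alpha)%E.
Proof.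
(* fine sends infinite values to 0, which positivity of h excludes *)
have hE : htop T [set: Omega] = (fine (htop T [set: Omega]))%:E.
  by case: (htop T _) nu_AB => [r| |] [] //=; rewrite ltxx.
move: nu_AB hE; set h := fine _ => nu_AB ->.
have below s : (s%:E < I_X alpha)%E ->
    s <= h /\ (htop T (level_set X alpha) <= (h - s)%:E)%E.
  exact: (@htop_level_set_le _ _ _ nu).
have I0 := rate_I.1 alpha.
case: (I_X alpha) I0 below => [r| |]// _ below.
- apply/lee_addgt0Pr => d d0.
  have [|_] := below (r - d); first by rewrite lte_fin ltrBlDr ltrDl.
  by rewrite -!EFinD opprB addrA addrAC.
(* an infinite rate would allow s = h + 1 *)
- have [|] := below (h + 1); first by rewrite ltry.
  by rewrite gerDl ler10.
Qed.
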